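(* Let $p\in\mathbb{Z}^n$ have positive components and $r\in\mathbb{Z}^n$, with $p$ and $r$ not parallel and $r_1/p_1\le\dots\le r_n/p_n$; put $q_i=r_i/p_i$. Let $M$ be an integer such that $f(M,1)\ge0$ and such that $a=pM+r$ has positive components, where $$f(M,\delta)=\left\lceil\frac{M+q_1-\delta}{q_n-q_1}\right\rceil-1 .$$ Then there is an integer $\beta$ with $$f(M,1)(M+q_n)<\beta<(f(M,1)+1)(M+q_1),$$ and for all such integers $\beta$ the infeasibility of $$ax=\beta,\quad x\ge0,\quad x\in\mathbb{Z}^n$$ is proven by $px\le f(M,1)\,\vee\,px\ge f(M,1)+1$.
   Context: $px$, $ax$ denote inner products. The LP relaxation of an integer program is obtained by dropping integrality. For an integer $k$, the infeasibility of an integer program is proven by $px \le k \vee px \ge k+1$ if both $\{x : px \le k\}$ and $\{x : px \ge k+1\}$ have empty intersection with the feasible set of its LP relaxation. *)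

(* Defs.v *)
(* MathComp world; the real numbers are an arbitrary R : realType. *)
From mathcomp Require Import all_boot all_order all_algebra.
From mathcomp Require Import boolp classical_sets reals.

Set Implicit Arguments.
Unset Strict Implicit.
Unset Printing Implicit Defensive.

Import Order.TTheory GRing.Theory Num.Theory.
Local Open Scope classical_set_scope.
Local Open Scope ring_scope.

Definition dot (R : realType) (n : nat) (c : 'rV[int]_n) (x : 'rV[R]_n) : R :=
  \sum_i (c 0 i)%:~R * x 0 i.

Definition real_vec (R : realType) (n : nat) (c : 'rV[int]_n) : 'rV[R]_n :=
  map_mx intr c.

(* The zero vector counts as parallel to every vector. *)
Definition parallel (F : fieldType) (n : nat) (u v : 'rV[F]_n) : Prop :=
  (exists c : F, u = c *: v) \/ (exists c : F, v = c *: u).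

(* An integer program in n variables is given by the real solution set of its
   constraints other than integrality; the requirement x \in Z^n is imposed
   by [feasible] and dropped by [lp_relaxation]. *)
Record integer_program (R : realType) (n : nat) :=
  IntegerProgram { constraints : set 'rV[R]_n }.

Definition feasible (R : realType) (n : nat) (P : integer_program R n)
    : set 'rV[R]_n :=
  constraints P `&` [set x | forall i, x 0 i \is a Num.int].

Definition lp_relaxation (R : realType) (n : nat) (P : integer_program R n)
    : set 'rV[R]_n :=
  constraints P.

Definition infeasibility_proven_by (R : realType) (n : nat)
    (P : integer_program R n) (p : 'rV[int]_n) (k : int) : Prop :=
  [set x | dot p x <= k%:~R] `&` lp_relaxation P = set0 /\
  [set x | (k + 1)%:~R <= dot p x] `&` lp_relaxation P = set0.

Lemma infeasibility_proven_by_feasible (R : realType) (n : nat)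
    (P : integer_program R n) (p : 'rV[int]_n) (k : int) :
  infeasibility_proven_by P p k -> feasible P = set0.
Proof.
move=> [le0 ge0]; apply/seteqP; split=> // x [Px xint].
have /intrP[m mE] : dot p x \is a Num.int.
  by apply: rpred_sum => i _; rewrite rpredM// intr_int.
have [mk|km] := leP m k.
  have : ([set x | dot p x <= k%:~R] `&` lp_relaxation P) x.
    by split=> //=; rewrite mE ler_int.
  by rewrite le0.
have : ([set x | (k + 1)%:~R <= dot p x] `&` lp_relaxation P) x.
  by split=> //=; rewrite mE ler_int lezD1.
by rewrite ge0.
Qed.

(* a x = beta, x >= 0, x \in Z^n *)
Definition knapsack (R : realType) (n : nat) (a : 'rV[int]_n) (beta : int)
    : integer_program R n :=
  IntegerProgram [set x | dot a x = beta%:~R /\ forall i, 0 <= x 0 i].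

Definition q (R : realType) (n : nat) (p r : 'rV[int]_n) (i : 'I_n) : R :=
  (r 0 i)%:~R / (p 0 i)%:~R.

(* Indices start at 0: q_1 and q_n are the values of q at ord0 and ord_max. *)
Definition f (R : realType) (n : nat) (p r : 'rV[int]_n.+1)
    (M : int) (delta : R) : int :=
  Num.ceil ((M%:~R + q R p r ord0 - delta) / (q R p r ord_max - q R p r ord0))
  - 1.

(* Main.v *)
Require Import Defs.
From mathcomp Require Import all_boot all_order all_algebra.
From mathcomp Require Import boolp classical_sets reals.
From mathcomp Require Import lra.

Set Implicit Arguments.
Unset Strict Implicit.
Unset Printing Implicit Defensive.

Import Order.TTheory GRing.Theory Num.Theory.
Local Open Scope ring_scope.

(** Write [D] for [q_n - q_1] and [k] for [f(M,1)].

    Since [a_i = p_i (M + q_i)] and [q_1 <= q_i <= q_n], every [x >= 0]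
    satisfies [(M + q_1) px <= ax <= (M + q_n) px] (lemmas [ge_dot_affine] and
    [le_dot_affine]).  Hence, as [M + q_1] and [M + q_n] are positive,
    [px <= k] forces [ax <= k (M + q_n)] and [px >= k + 1] forces
    [ax >= (k + 1) (M + q_1)]; neither is compatible with [ax = beta] when
    [beta] lies strictly between these two bounds.

    Such a [beta] exists because the gap between the bounds is
    [M + q_1 - k D], and [k] is by construction the largest integer with
    [k D < M + q_1 - 1], so the gap is more than 1 (lemma [f_mul_lt]).  This
    uses [D > 0], which is where non-parallelism enters: if [q_1 = q_n] then
    all ratios [r_i / p_i] coincide and [r] is a multiple of [p] (lemma
    [q_gap_gt0]). *)

Lemma exists_int_between (R : realType) (x y : R) :
  x + 1 < y -> exists m : int, x < m%:~R < y.
Proof.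
move=> xy; exists (Num.floor x + 1).
rewrite floorD1_gt /=; apply: le_lt_trans xy.
by rewrite intrD lerD2r floor_le.
Qed.

Section Ratios.
Variables (R : realType) (n : nat) (p r : 'rV[int]_n) (M : int).
Hypothesis p_gt0 : forall i, 0 < p 0 i.

Lemma affine_coordE i :
  ((M *: p + r) 0 i)%:~R = (p 0 i)%:~R * (M%:~R + q R p r i).
Proof.
have p0 : (p 0 i)%:~R != 0 :> R by rewrite intr_eq0 gt_eqF.
by rewrite !mxE intrD intrM /q mulrDr mulrCA divff// mulr1 mulrC.
Qed.

Lemma affine_q_gt0 i : 0 < (M *: p + r) 0 i -> 0 < M%:~R + q R p r i.
Proof. by rewrite -(ltr0z R) affine_coordE pmulr_rgt0// ltr0z. Qed.

Variable x : 'rV[R]_n.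
Hypothesis x_ge0 : forall i, 0 <= x 0 i.

Lemma le_dot_affine c : (forall i, q R p r i <= c) ->
  dot (M *: p + r) x <= (M%:~R + c) * dot p x.
Proof.
move=> qc; rewrite /dot mulr_sumr ler_sum// => i _.
rewrite affine_coordE mulrA ler_wpM2r// mulrC ler_wpM2r ?lerD2l//.
by rewrite ler0z ltW.
Qed.

Lemma ge_dot_affine c : (forall i, c <= q R p r i) ->
  (M%:~R + c) * dot p x <= dot (M *: p + r) x.
Proof.
move=> cq; rewrite /dot mulr_sumr ler_sum// => i _.
rewrite affine_coordE mulrA ler_wpM2r// mulrC ler_wpM2l ?lerD2l//.
by rewrite ler0z ltW.
Qed.

End Ratios.

Lemma q_gap_gt0 (R : realType) (n : nat) (p r : 'rV[int]_n.+1) :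
  (forall i, 0 < p 0 i) ->
  ~ parallel (real_vec R p) (real_vec R r) ->
  (forall i, q R p r ord0 <= q R p r i <= q R p r ord_max) ->
  0 < q R p r ord_max - q R p r ord0.
Proof.
move=> p_gt0 npar qb; rewrite subr_gt0 ltNge; apply/negP => qle.
apply: npar; right; exists (q R p r ord0); apply/rowP => i.
have -> : q R p r ord0 = q R p r i.
  have /andP[q0i qin] := qb i.
  by apply/eqP; rewrite eq_le q0i (le_trans qin).
by rewrite !mxE /q divfK// intr_eq0 gt_eqF.
Qed.

(** Holds because [ceil t - 1] is always strictly less than [t], even when [t]
    is an integer; at [delta = 1] the strictness is what makes the interval of
    admissible [beta] longer than 1. *)
Lemma f_mul_lt (R : realType) (n : nat) (p r : 'rV[int]_n.+1) (M : int)
    (delta : R) :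
  0 < q R p r ord_max - q R p r ord0 ->
  (f p r M delta)%:~R * (q R p r ord_max - q R p r ord0)
    < M%:~R + q R p r ord0 - delta.
Proof. by move=> D_gt0; rewrite -ltr_pdivlMr// /f ceilB1_lt. Qed.

Theorem theorem5 (R : realType) (n : nat) (p r : 'rV[int]_n.+1) (M : int)
    (p_gt0 : forall i, 0 < p 0 i)
    (p_r_not_parallel : ~ parallel (real_vec R p) (real_vec R r))
    (q_sorted : forall i j : 'I_n.+1, (i <= j)%N -> q R p r i <= q R p r j)
    (f_ge0 : 0 <= f p r M (1 : R))
    (a_gt0 : forall i, 0 < (M *: p + r) 0 i) :
  (exists beta : int,
     (f p r M (1 : R))%:~R * (M%:~R + q R p r ord_max) < beta%:~R
       < (f p r M (1 : R) + 1)%:~R * (M%:~R + q R p r ord0)) /\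
  (forall beta : int,
     (f p r M (1 : R))%:~R * (M%:~R + q R p r ord_max) < beta%:~R
       < (f p r M (1 : R) + 1)%:~R * (M%:~R + q R p r ord0) ->
     infeasibility_proven_by (knapsack R (M *: p + r) beta) p
       (f p r M (1 : R))).
Proof.
have q_ge i : q R p r ord0 <= q R p r i by exact: q_sorted.
have q_le i : q R p r i <= q R p r ord_max by apply: q_sorted; exact: leq_ord.
split.
  apply: exists_int_between.
  have D_gt0 : 0 < q R p r ord_max - q R p r ord0.
    by apply: q_gap_gt0 => // i; rewrite q_ge q_le.
  have := f_mul_lt M 1 D_gt0.
  rewrite intrD mulrDl mul1r; lra.
move=> beta /andP[lo hi].
split; apply/seteqP; split=> //= x [px [axE x_ge0]].
- have axle := le_dot_affine M p_gt0 x_ge0 q_le.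
  have := lt_le_trans lo (le_trans _ axle); rewrite axE lexx => /(_ isT).
  rewrite mulrC ltr_pM2l; last exact: affine_q_gt0.
  by rewrite ltNge px.
- have axge := ge_dot_affine M p_gt0 x_ge0 q_ge.
  have := le_lt_trans axge; rewrite axE => /(_ _ hi).
  rewrite mulrC ltr_pM2r; last exact: affine_q_gt0.
  by rewrite ltNge px.
Qed.
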